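(* Let $n,m\ge 1$, let $A\in\mathbb{R}^{n\times n}$ and let $B\in\mathbb{R}^{n\times m}$ have full column rank. Assume that the pair $(A,B)$ satisfies the Kalman rank condition. Then the bilinear system $$\dot\Phi_t=(A+BK_t)\Phi_t,$$ with control $K_\cdot$ taking values in $\mathbb{R}^{m\times n}$, is controllable on $\mathrm{GL}^+(n,\mathbb{R})$.
   Context: $\mathrm{GL}^+(n,\mathbb{R})$ is the group of real $n\times n$ matrices with positive determinant. The pair $(A,B)$ satisfies the Kalman rank condition if $\mathrm{rank}[B, AB,\dots,A^{n-1}B]=n$. The bilinear system is controllable on $\mathrm{GL}^+(n,\mathbb{R})$ if for every $\Phi_{\mathrm{fn}}\in \mathrm{GL}^+(n,\mathbb{R})$ there exist a time $t_{\mathrm{fn}}>0$ and an integrable control $K_\cdot:[0,t_{\mathrm{fn}}]\to\mathbb{R}^{m\times n}$ such that the (absolutely continuous) solution with $\Phi_0=I$ satisfies $\Phi_{t_{\mathrm{fn}}}=\Phi_{\mathrm{fn}}$. *)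

(* Defs.v *)
From mathcomp Require Import all_boot all_order all_algebra.
From mathcomp Require Import all_classical all_reals all_analysis.

Set Implicit Arguments.
Unset Strict Implicit.
Unset Printing Implicit Defensive.

Import Order.TTheory GRing.Theory Num.Theory.
Import numFieldNormedType.Exports.

Local Open Scope classical_set_scope.
Local Open Scope ring_scope.

Definition GLplus (R : realType) (n : nat) : set 'M[R]_n :=
  [set M | 0 < \det M].

Definition kalman_mx (R : realType) (n m : nat) (A : 'M[R]_n)
    (B : 'M[R]_(n, m)) : 'M[R]_(n, \sum_(k < n) m) :=
  \mxrow_(k < n) (A ^+ k *m B).

Definition kalman_rank_condition (R : realType) (n m : nat) (A : 'M[R]_n)
    (B : 'M[R]_(n, m)) : Prop :=
  \rank (kalman_mx A B) = n.

Definition abs_continuous_on (R : realType) (V : normedModType R) (a b : R)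
    (f : R -> V) : Prop :=
  forall eps : R, 0 < eps ->
  exists2 delta : R, 0 < delta &
    forall (N : nat) (u v : 'I_N -> R),
      (forall i, a <= u i /\ u i <= v i /\ v i <= b) ->
      trivIset setT (fun i => `]u i, v i[%classic) ->
      \sum_(i < N) (v i - u i) < delta ->
      \sum_(i < N) `|f (v i) - f (u i)| < eps.

(* Matrix-valued functions are integrable when all their entries are. *)
Definition mx_integrable (R : realType) (p q : nat) (D : set R)
    (K : R -> 'M[R]_(p, q)) : Prop :=
  forall i j,
    (@lebesgue_measure R).-integrable D (fun s => (K s i j)%:E).

(* Controls and trajectories on [0, t] are total functions on R, of which only
   the restriction to [0, t] matters; the differential equation is required
   almost everywhere, so the endpoints can be left out. *)
Definition bilinear_solution (R : realType) (n m : nat) (A : 'M[R]_n)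
    (B : 'M[R]_(n, m)) (t : R) (K : R -> 'M[R]_(m, n)) (Phi : R -> 'M[R]_n) :
    Prop :=
  [/\ abs_continuous_on 0 t Phi,
      Phi 0 = 1%:M &
      {ae (@lebesgue_measure R), forall s, s \in `]0, t[ ->
        is_derive s 1 Phi ((A + B *m K s) *m Phi s)}].

(* For an integrable K the Caratheodory solution of the linear equation with
   Phi 0 = I is unique on [0, t], so asserting that some solution reaches
   Phi_fn at time t says that the solution does. *)
Definition bilinear_controllable (R : realType) (n m : nat) (A : 'M[R]_n)
    (B : 'M[R]_(n, m)) : Prop :=
  forall Phi_fn : 'M[R]_n, GLplus Phi_fn ->
  exists t : R, 0 < t /\
  exists2 K : R -> 'M[R]_(m, n), mx_integrable `[0, t] K &
  exists2 Phi : R -> 'M[R]_n, bilinear_solution A B t K Phi & Phi t = Phi_fn.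

(* Main.v *)
Require Import Defs.
From mathcomp Require Import all_boot all_order all_algebra.
From mathcomp Require Import all_classical all_reals all_analysis.
From mathcomp Require Import measurable_realfun polyrcf.
From mathcomp Require Import ring lra.

(* With U = K Phi the equation is the linear system Phi' = A Phi + B U, and any
   of its trajectories that stays invertible comes from the control
   K = U Phi^-1. The Kalman condition yields a polynomial trajectory Z with
   Z(0) = I. Put N = adj(Z) B and W(t) = int_0^t N N^T, which is symmetric and
   positive definite for small t > 0. If S + S^T is positive definite then
   Z (I + W (S - W(T)^-1)) is again a trajectory; it stays invertible because
   0 <= W(t) <= W(T), and it ends at G S with G = Z(T) W(T), det G > 0.
   Let P be the set of the matrices with positive definite symmetric part. The
   reachable set is a semigroup containing G P. Since g^T P g = P, we get
   (G P)^k = g_k P^k for some g_k of positive determinant. Gaussian elimination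
   shows that P^k is all of GL+ for some k depending only on n, and hence so is
   the reachable set. *)

Set Implicit Arguments.
Unset Strict Implicit.
Unset Printing Implicit Defensive.

Import Order.TTheory GRing.Theory Num.Theory.
Import numFieldNormedType.Exports.

Local Open Scope classical_set_scope.
Local Open Scope ring_scope.

Local Notation mxC := (map_mx polyC).
Local Notation mxderiv := (map_mx deriv).
Local Notation mxeval t := (map_mx (horner_eval t)).

(** * Matrices with positive definite symmetric part *)

Definition mxform (R : comNzRingType) n (M : 'M[R]_n) (u v : 'rV[R]_n) : R :=
  (u *m M *m v^T) 0 0.

(* No symmetry is required: only the symmetric part of [M] matters. *)
Definition posdef (R : numDomainType) n (M : 'M[R]_n) : Prop :=
  forall v : 'rV[R]_n, v != 0 -> 0 < mxform M v v.

Section MxForm.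
Variables (R : comNzRingType) (n : nat).
Implicit Types (M N : 'M[R]_n) (u v w : 'rV[R]_n).

Lemma mxform_tr M u v : mxform M^T u v = mxform M v u.
Proof.
transitivity ((u *m M^T *m v^T)^T 0 0); first by rewrite mxE.
by rewrite !trmx_mul !trmxK mulmxA.
Qed.

Lemma mxformD M N u v : mxform (M + N) u v = mxform M u v + mxform N u v.
Proof. by rewrite /mxform mulmxDr mulmxDl mxE. Qed.

Lemma mxformZ a M u v : mxform (a *: M) u v = a * mxform M u v.
Proof. by rewrite /mxform -scalemxAr -scalemxAl mxE. Qed.

Lemma mxformDl M u v w : mxform M (u + v) w = mxform M u w + mxform M v w.
Proof. by rewrite /mxform !mulmxDl mxE. Qed.

Lemma mxformDr M u v w : mxform M u (v + w) = mxform M u v + mxform M u w.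
Proof. by rewrite /mxform linearD mulmxDr mxE. Qed.

Lemma mxformNr M u v : mxform M u (- v) = - mxform M u v.
Proof. by rewrite /mxform linearN mulmxN mxE. Qed.

Lemma mxformNl M u v : mxform M (- u) v = - mxform M u v.
Proof. by rewrite /mxform !mulNmx mxE. Qed.

Lemma mxform1 u v : mxform 1%:M u v = \sum_i u 0 i * v 0 i.
Proof. by rewrite /mxform mulmx1 mxE; apply: eq_bigr => i _; rewrite mxE. Qed.

Lemma mxform_congr M N u v : mxform (N *m M *m N^T) u v = mxform M (u *m N) (v *m N).
Proof. by rewrite /mxform trmx_mul !mulmxA. Qed.

End MxForm.

Section PosDef.
Variables (R : realFieldType).

Lemma mxform1_gt0 n (v : 'rV[R]_n) : v != 0 -> 0 < mxform 1%:M v v.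
Proof.
move=> v0; rewrite mxform1 lt_neqAle eq_sym sumr_ge0 ?andbT => [|i _]; last first.
  by rewrite -expr2 sqr_ge0.
apply: contra v0; rewrite psumr_eq0 => [/allP h|i _]; last first.
  by rewrite -expr2 sqr_ge0.
apply/eqP/rowP => i; rewrite mxE; apply/eqP.
by have := h i (mem_index_enum _); rewrite /= mulf_eq0 orbb.
Qed.

Lemma posdef1 n : posdef (1%:M : 'M[R]_n).
Proof. by move=> v; exact: mxform1_gt0. Qed.

Lemma posdefD n (M N : 'M[R]_n) : posdef M -> posdef N -> posdef (M + N).
Proof. by move=> hM hN v v0; rewrite mxformD addr_gt0 ?hM ?hN. Qed.

Lemma posdefZ n a (M : 'M[R]_n) : 0 < a -> posdef M -> posdef (a *: M).
Proof. by move=> a0 hM v v0; rewrite mxformZ mulr_gt0 ?hM. Qed.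

Lemma posdef_tr n (M : 'M[R]_n) : posdef M -> posdef M^T.
Proof. by move=> hM v v0; rewrite mxform_tr hM. Qed.

Lemma unitmx_ker0 n (M : 'M[R]_n) :
  (forall v : 'rV[R]_n, v *m M = 0 -> v = 0) -> M \in unitmx.
Proof.
move=> h; rewrite -row_free_unit -kermx_eq0; apply/eqP/row_matrixP => i.
by rewrite row0; apply: h; rewrite -row_mul mulmx_ker row0.
Qed.

Lemma posdef_unit n (M : 'M[R]_n) : posdef M -> M \in unitmx.
Proof.
move=> hM; apply: unitmx_ker0 => v vM; apply/eqP; apply: contraT => v0.
by have := hM _ v0; rewrite /mxform vM mul0mx mxE ltxx.
Qed.

Lemma posdef_congr n (M N : 'M[R]_n) :
  N \in unitmx -> posdef M -> posdef (N *m M *m N^T).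
Proof.
move=> uN hM v v0; rewrite mxform_congr; apply: hM.
by apply: contra v0 => /eqP /(congr1 (mulmx^~ (invmx N))); rewrite mulmxK // mul0mx => ->.
Qed.

(** * Products of matrices with positive definite symmetric part *)

Fixpoint posdef_prod n k (M : 'M[R]_n) : Prop :=
  if k is k'.+1 then exists S N, [/\ posdef S, posdef_prod k' N & M = S *m N]
  else M = 1%:M.

Lemma posdef_prod1 n (M : 'M[R]_n) : posdef M -> posdef_prod 1 M.
Proof. by move=> hM; exists M, 1%:M; rewrite mulmx1. Qed.

Lemma posdef_prodM n j k (M N : 'M[R]_n) :
  posdef_prod j M -> posdef_prod k N -> posdef_prod (j + k) (M *m N).
Proof.
elim: j M => [M -> hN|j IH M [S [M' [hS hM' ->]]] hN]; first by rewrite mul1mx.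
by exists S, (M' *m N); split; [| exact: IH | rewrite mulmxA].
Qed.

Lemma posdef_block1 p q (S : 'M[R]_q) :
  posdef S -> posdef (block_mx (1%:M : 'M[R]_p) 0 0 S).
Proof.
move=> hS v v0; rewrite /mxform -(hsubmxK v) tr_row_mx mul_row_block mul_row_col.
rewrite !mulmx0 addr0 add0r mxE -/(mxform _ _ _) -/(mxform _ _ _).
have ge0 k (M : 'M[R]_k) w : posdef M -> 0 <= mxform M w w.
  move=> hM; have [->|/hM/ltW//] := eqVneq w 0.
  by rewrite /mxform !mul0mx mxE.
have [l0|l0] := eqVneq (lsubmx v) 0.
  rewrite ltr_wpDl ?ge0//; first exact: posdef1.
  apply: hS; apply: contra v0 => /eqP r0.
  by rewrite -(hsubmxK v) l0 r0 row_mx0.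
by rewrite ltr_wpDr ?ge0// posdef1.
Qed.

Lemma posdef_prod_block1 p q k (M : 'M[R]_q) :
  posdef_prod k M -> posdef_prod k (block_mx (1%:M : 'M[R]_p) 0 0 M).
Proof.
elim: k M => [M ->|k IH M [S [N [hS hN ->]]]]; first by rewrite -scalar_mx_block.
exists (block_mx 1%:M 0 0 S), (block_mx 1%:M 0 0 N); split; [exact: posdef_block1|exact: IH|].
by rewrite mulmx_block !mul0mx !mulmx0 !mul1mx !addr0 !add0r.
Qed.

Lemma posdef_prod_tr n k (M : 'M[R]_n) : posdef_prod k M -> posdef_prod k M^T.
Proof.
elim: k M => [M ->|k IH M [S [N [hS hN ->]]]]; first by rewrite trmx1.
rewrite trmx_mul -addn1; apply: posdef_prodM; first exact: IH.
exact/posdef_prod1/posdef_tr.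
Qed.

Lemma posdef_diag c n : 0 < c ->
  posdef (block_mx c%:M 0 0 1%:M : 'M[R]_(1 + n)).
Proof.
move=> c0 v v0; rewrite /mxform -(hsubmxK v) tr_row_mx mul_row_block mul_row_col.
rewrite !mulmx0 addr0 add0r mul_mx_scalar -scalemxAl.
set a := lsubmx v *m _; set b := _ *m (rsubmx v)^T.
rewrite 2!mxE.
have -> : a 0 0 = mxform 1%:M (lsubmx v) (lsubmx v) by rewrite /mxform mulmx1.
have ge0 k (w : 'rV[R]_k) : 0 <= mxform 1%:M w w.
  have [->|/posdef1/ltW//] := eqVneq w 0.
  by rewrite /mxform !mul0mx mxE.
have -> : b 0 0 = mxform 1%:M (rsubmx v) (rsubmx v) by [].
have [l0|l0] := eqVneq (lsubmx v) 0.
  rewrite ltr_wpDl ?mulr_ge0 ?ge0// ?(ltW c0) //.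
  apply: posdef1; apply: contra v0 => /eqP r0.
  by rewrite -(hsubmxK v) l0 r0 row_mx0.
by rewrite ltr_wpDr ?ge0// mulr_gt0// posdef1.
Qed.

(** At [(x, y)] the form is [x^2 + x (w . y) + |y|^2], and the cross term is at least
    [-(x^2 |w|^2 + |y|^2) / 2]. *)
Lemma posdef_transvection n (w : 'rV[R]_n) :
  \sum_i w 0 i ^+ 2 < 1 -> posdef (block_mx 1%:M w 0 1%:M : 'M[R]_(1 + n)).
Proof.
move=> hw v v0; rewrite /mxform -(hsubmxK v) tr_row_mx mul_row_block mul_row_col.
rewrite !mulmx0 addr0 !mulmx1.
set x := lsubmx v; set y := rsubmx v.
rewrite mulmxDl addrCA addrC; rewrite 2!mxE.
have -> : (y *m y^T) 0 0 = \sum_i y 0 i ^+ 2.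
  by rewrite mxE; apply: eq_bigr => i _; rewrite [_^T _ _]mxE.
have -> : (x *m x^T) 0 0 = x 0 0 ^+ 2 by rewrite mxE big_ord1 [_^T _ _]mxE.
have -> : (x *m w *m y^T) 0 0 = \sum_i x 0 0 * w 0 i * y 0 i.
  by rewrite mxE; apply: eq_bigr => i _; rewrite [_^T _ _]mxE [(x *m w) _ _]mxE big_ord1.
have cs : - \sum_i x 0 0 * w 0 i * y 0 i <=
    2^-1 * (x 0 0 ^+ 2 * (\sum_i w 0 i ^+ 2) + \sum_i y 0 i ^+ 2).
  rewrite -sumrN mulr_sumr -big_split /= mulr_sumr; apply: ler_sum => i _.
  by have := sqr_ge0 (x 0 0 * w 0 i + y 0 i); lra.
have y0 : 0 <= \sum_i y 0 i ^+ 2 by apply: sumr_ge0 => i _; exact: sqr_ge0.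
have [l0|l0] := eqVneq (x 0 0) 0.
  have : y != 0.
    apply: contra v0 => /eqP r0; rewrite -(hsubmxK v) -/x -/y r0.
    suff -> : x = 0 by rewrite row_mx0.
    by apply/rowP => i; rewrite ord1 l0 mxE.
  move/(@mxform1_gt0 n); rewrite mxform1 => y1.
  have -> : \sum_i y 0 i ^+ 2 = \sum_i y 0 i * y 0 i by apply: eq_bigr => i _.
  rewrite [X in _ + X]big1 => [|i _]; last by rewrite l0 !mul0r.
  by rewrite l0 expr0n /= addr0 add0r.
have x2 : 0 < x 0 0 ^+ 2 by rewrite exprn_even_gt0.
have := ltr_pM2l x2 (\sum_i w 0 i ^+ 2) 1; rewrite hw mulr1 => h.
by lra.
Qed.

(** Conjugation by [diag(c, 1)] rescales [w], so an arbitrary transvection reduces to one with a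
    short [w]. *)
Lemma transvection_prod n (w : 'rV[R]_n) :
  posdef_prod 3 (block_mx 1%:M w 0 1%:M : 'M[R]_(1 + n)).
Proof.
(* With [c = 1 + |w|^2] one has [|w / c|^2 = s / c^2 < 1]. *)
pose s := \sum_i w 0 i ^+ 2; pose c := 1 + s.
have s0 : 0 <= s by apply: sumr_ge0 => i _; exact: sqr_ge0.
have c0 : 0 < c by rewrite /c; lra.
exists (block_mx c%:M 0 0 1%:M).
exists (block_mx 1%:M (c^-1 *: w) 0 1%:M *m block_mx c^-1%:M 0 0 1%:M); split.
- exact: posdef_diag.
- exists (block_mx 1%:M (c^-1 *: w) 0 1%:M), (block_mx c^-1%:M 0 0 1%:M); split => //.
    apply: posdef_transvection.
    have -> : \sum_i (c^-1 *: w) 0 i ^+ 2 = c^-1 ^+ 2 * s.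
      by rewrite mulr_sumr; apply: eq_bigr => i _; rewrite mxE exprMn.
    rewrite exprVn mulrC ltr_pdivrMr ?exprn_gt0 // mul1r expr2.
    have : c * 1 <= c * c by rewrite ler_pM2l // /c; lra.
    by rewrite {1}/c; lra.
  by apply: posdef_prod1; apply: posdef_diag; rewrite invr_gt0.
rewrite mulmxA !mulmx_block !mulmx0 !mul0mx !mulmx1 ?mul1mx ?addr0 ?add0r.
rewrite mul0mx -scalar_mxM divff ?gt_eqF // mul_scalar_mx scalerA divff ?gt_eqF //.
by rewrite scale1r.
Qed.

Lemma transvection_prod_tr n (w : 'cV[R]_n) :
  posdef_prod 3 (block_mx 1%:M 0 w 1%:M : 'M[R]_(1 + n)).
Proof.
have := posdef_prod_tr (transvection_prod w^T).
by rewrite tr_block_mx !trmx1 trmxK trmx0.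
Qed.

(** Once some entry below the corner is nonzero, a multiple of its row added to the first row makes
    the corner 1, whatever the sign of the old corner. *)
Lemma pivot1 n (M : 'M[R]_(1 + n.+1)) : \det M != 0 ->
  exists (v : 'cV[R]_n.+1) (w : 'rV[R]_n.+1),
    ulsubmx (block_mx 1%:M w 0 1%:M *m (block_mx 1%:M 0 v 1%:M *m M)) = 1%:M.
Proof.
move=> dM; pose a := ulsubmx M; pose b := dlsubmx M.
(* If [b = 0] then [a] is nonzero by invertibility, and adding the first row to the next one makes
   the lower part nonzero. *)
have [v hv] : exists v : 'cV_n.+1, v *m a + b != 0.
  have [b0|] := eqVneq b 0; last by exists 0; rewrite mul0mx add0r.
  exists (delta_mx 0 0); rewrite b0 addr0; apply: contra dM => /eqP h.
  have a0 : a = 0.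
    apply/matrixP => i j; rewrite !ord1 [RHS]mxE.
    by move/matrixP/(_ 0 0): h; rewrite !mxE big_ord1 !mxE /= mul1r.
  by rewrite -(submxK M) -/a -/b a0 b0 det_ublock det_mx11 mxE mul0r.
have [i hi] : exists i, (v *m a + b) i 0 != 0.
  apply/existsP; apply: contraT; rewrite negb_exists => /forallP h.
  case/eqP: hv; apply/matrixP => i j; rewrite !ord1 [RHS]mxE.
  by apply/eqP; have := h i; rewrite negbK.
exists v, (((1 - a 0 0) / (v *m a + b) i 0) *: delta_mx 0 i).
rewrite -{1}(submxK M) !mulmx_block block_mxKul !mul1mx !mul0mx !addr0 -/a -/b.
rewrite -scalemxAl -rowE; move: (v *m a + b) hi => u hi.
apply/matrixP => k l; rewrite !ord1 [LHS]mxE.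
rewrite [X in _ + X]mxE [X in _ * X]mxE divfK // addrC subrK mxE.
by [].
Qed.

(* [k] must not depend on [M], because the matrix [g] in
   [semigroup_posdef_prod] depends on [k]. *)
Lemma GLplus_posdef_prod n :
  exists k, forall M : 'M[R]_n.+1, 0 < \det M -> posdef_prod k M.
Proof.
elim: n => [|n [k IH]].
  exists 1%N => M; rewrite det_mx11 => M0; apply: posdef_prod1 => v v0.
  rewrite (mx11_scalar M) /mxform mul_mx_scalar -scalemxAl mxE mulr_gt0//.
  by have := posdef1 v0; rewrite /mxform mulmx1.
(* Four transvections at 3 factors each: [L'], [U'] and the two that clear the first column and row;
   the remaining block takes [k]. *)
exists ((3 + (3 + 3)) + (k + 3))%N => M M0.
have [v [w]] := pivot1 (lt0r_neq0 M0).
set L := block_mx _ 0 v _; set U := block_mx _ w 0 _; set M' := U *m _ => hM'.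
have dM' : \det M' = \det M.
  by rewrite /M' !det_mulmx /U /L det_ublock det_lblock !det1 !mul1r.
pose L' := block_mx 1%:M 0 (- v) 1%:M; pose U' := block_mx 1%:M (- w) 0 1%:M.
have LL : L' *m L = 1%:M.
  rewrite mulmx_block !mulmx0 !mul0mx !mulmx1 !mul1mx !addr0 !add0r.
  by rewrite addNr -scalar_mx_block.
have UU : U' *m U = 1%:M.
  rewrite mulmx_block !mulmx0 !mul0mx !mulmx1 !mul1mx !addr0 !add0r.
  by rewrite subrr -scalar_mx_block.
have -> : M = L' *m U' *m M'.
  by rewrite /M' mulmxA -(mulmxA L') UU mulmx1 mulmxA LL mul1mx.
(* [D] is the Schur complement of the pivot 1, hence [\det D = \det M]. *)
pose c := dlsubmx M'; pose r := ursubmx M'; pose D := drsubmx M' - c *m r.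
have eM' : M' = block_mx 1%:M 0 c 1%:M *m (block_mx 1%:M 0 0 D *m block_mx 1%:M r 0 1%:M).
  rewrite !mulmx_block !mulmx0 !mul0mx !mulmx1 !mul1mx !addr0 !add0r.
  by rewrite -[LHS]submxK hM' /D addrC subrK mulmx1.
have dD : 0 < \det D.
  move: M0; rewrite -dM' eM' !det_mulmx det_lblock !det_ublock.
  by rewrite !det1 !mulr1 !mul1r.
rewrite eM' mulmxA; apply: posdef_prodM.
  rewrite -mulmxA; apply: posdef_prodM; first exact: transvection_prod_tr.
  by apply: posdef_prodM; [exact: transvection_prod|exact: transvection_prod_tr].
apply: posdef_prodM; last exact: transvection_prod.
exact/posdef_prod_block1/IH.
Qed.

End PosDef.

(** The segment from [S] to the identity consists of invertible matrices, so the determinant, a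
    polynomial along it, cannot change sign. Symmetry of [S] is not assumed, so no diagonalization
    is available. *)
Lemma posdef_det_gt0 (R : rcfType) n (S : 'M[R]_n) : posdef S -> 0 < \det S.
Proof.
move=> hS; rewrite ltNge; apply/negP => dS.
pose p := \det (map_mx polyC S + 'X *: map_mx polyC (1%:M - S)).
have pE x : p.[x] = \det (S + x *: (1%:M - S)).
  rewrite /p -[LHS]/(horner_eval x _) -det_map_mx /=; congr (\det _).
  by apply/matrixP => i j; rewrite !mxE /horner_eval !hornerE.
have [|x /andP[x0 x1] /rootP] := @poly_ivt _ p 0 1 ler01.
  by rewrite !pE scale0r addr0 dS scale1r addrCA subrr addr0 det1 ler01.
rewrite pE; suff: posdef (S + x *: (1%:M - S)).
  by move/posdef_unit; rewrite unitmxE unitfE => /eqP.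
have -> : S + x *: (1%:M - S) = (1 - x) *: S + x *: 1%:M.
  by rewrite scalerBr scalerBl scale1r addrCA addrC.
have [->|xn0] := eqVneq x 0; first by rewrite subr0 scale0r addr0 scale1r.
have [->|xn1] := eqVneq x 1; first by rewrite subrr scale0r add0r scale1r; exact: posdef1.
apply: posdefD; apply: posdefZ => //; try exact: posdef1.
  by rewrite subr_gt0 lt_neqAle xn1.
by rewrite lt_neqAle eq_sym xn0.
Qed.

(* [G * posdef] is moved past [g] by the congruence [S = g^T (g^-T S g^-1) g]. *)
Lemma semigroup_posdef_prod (R : rcfType) n (Rch : 'M[R]_n -> Prop) (G : 'M[R]_n) :
  (forall M N, Rch M -> Rch N -> Rch (M *m N)) ->
  0 < \det G -> (forall S, posdef S -> Rch (G *m S)) ->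
  forall k, exists2 g, 0 < \det g & forall M, posdef_prod k.+1 M -> Rch (g *m M).
Proof.
move=> RchM dG RG; elim=> [|k [g dg IH]].
  by exists G => // M [S [N [hS -> ->]]]; rewrite mulmx1; exact: RG.
have ug : g \in unitmx by rewrite unitmxE unitfE gt_eqF.
exists (G *m invmx g^T).
  by rewrite det_mulmx det_inv det_tr mulr_gt0// invr_gt0.
move=> M [S [N [hS hN ->]]].
have -> : G *m invmx g^T *m (S *m N) =
    G *m (invmx g^T *m S *m (invmx g^T)^T) *m (g *m N).
  by rewrite trmx_inv trmxK !mulmxA mulmxKV.
apply: RchM; last exact: IH.
by apply/RG/posdef_congr => //; rewrite unitmx_inv unitmx_tr.
Qed.

Lemma semigroup_GLplus (R : rcfType) n (Rch : 'M[R]_n.+1 -> Prop) (G : 'M[R]_n.+1) :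
  (forall M N, Rch M -> Rch N -> Rch (M *m N)) ->
  0 < \det G -> (forall S, posdef S -> Rch (G *m S)) ->
  forall M, 0 < \det M -> Rch M.
Proof.
move=> RchM dG RG M dM; have [k hk] := GLplus_posdef_prod R n.
have [g dg hg] := semigroup_posdef_prod RchM dG RG k.
have ug : g \in unitmx by rewrite unitmxE unitfE gt_eqF.
rewrite -(mulKVmx ug M); apply: hg.
(* [g] serves products of [k.+1] factors, so the [k] factors of [g^-1 M] are padded by the
   identity. *)
exists 1%:M, (invmx g *m M); split; [exact: posdef1| |by rewrite mul1mx].
by apply: hk; rewrite det_mulmx det_inv mulr_gt0 ?invr_gt0.
Qed.

(** * Polynomial trajectories *)

Lemma mxderivM (R : comNzRingType) p q r
    (M : 'M[{poly R}]_(p, q)) (N : 'M[{poly R}]_(q, r)) :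
  mxderiv (M *m N) = mxderiv M *m N + M *m mxderiv N.
Proof.
apply/matrixP => i j; rewrite !mxE raddf_sum -big_split /=; apply: eq_bigr => k _.
by rewrite !mxE derivM.
Qed.

Lemma mxderivC (R : comNzRingType) p q (M : 'M[R]_(p, q)) : mxderiv (mxC M) = 0.
Proof. by apply/matrixP => i j; rewrite !mxE derivC. Qed.

Lemma mxderivCM (R : comNzRingType) p q r (M : 'M[R]_(p, q)) (N : 'M[{poly R}]_(q, r)) :
  mxderiv (mxC M *m N) = mxC M *m mxderiv N.
Proof. by rewrite mxderivM mxderivC mul0mx add0r. Qed.

Lemma mxderivMC (R : comNzRingType) p q r (M : 'M[{poly R}]_(p, q)) (N : 'M[R]_(q, r)) :
  mxderiv (M *m mxC N) = mxderiv M *m mxC N.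
Proof. by rewrite mxderivM mxderivC mulmx0 addr0. Qed.

Lemma mxevalC (R : comNzRingType) p q (M : 'M[R]_(p, q)) t : mxeval t (mxC M) = M.
Proof. by apply/matrixP => i j; rewrite !mxE /horner_eval hornerC. Qed.

Section Antiderivative.
Variable R : numFieldType.

(** The antiderivative vanishing at 0: at [i = 0] the quotient by [0%:R] is 0 by convention. *)
Definition polyint (p : {poly R}) : {poly R} :=
  \poly_(i < (size p).+1) (p`_i.-1 / i%:R).

Lemma deriv_polyint p : (polyint p)^`() = p.
Proof.
apply/polyP => i; rewrite coef_deriv coef_poly ltnS /=.
have [ip|/(nth_default 0)->] := ltnP i (size p); last by rewrite mul0rn.
by rewrite -[LHS]mulr_natr divfK // pnatr_eq0.
Qed.

Lemma horner_polyint0 p : (polyint p).[0] = 0.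
Proof. by rewrite horner_coef0 coef_poly invr0 mulr0. Qed.

(** Terms of the exponential series: the [F k] in a sum of [exp_poly k *: F k] are its derivatives
    at 0. *)
Definition exp_poly k : {poly R} := (k`!%:R)^-1 *: 'X^k.

Lemma deriv_exp_poly k : (exp_poly k.+1)^`() = exp_poly k.
Proof.
rewrite /exp_poly derivZ derivXn /= -(scaler_nat k.+1 'X^k) scalerA; congr (_ *: _).
by rewrite factS natrM invfM mulrC mulrA divff ?mul1r // pnatr_eq0.
Qed.

(** Differentiation shifts the coefficients; the vanishing of [F N.+1] lets both sums run over the
    same range. *)
Lemma mxderiv_exp p q (F : nat -> 'M[R]_(p, q)) N : F N.+1 = 0 ->
  mxderiv (\sum_(k < N.+1) exp_poly k *: mxC (F k)) =
  \sum_(k < N.+1) exp_poly k *: mxC (F k.+1).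
Proof.
move=> FN; rewrite [RHS]big_ord_recr /= FN map_mx0 scaler0 addr0.
rewrite big_ord_recl raddfD raddf_sum /= [X in X + _](_ : _ = 0) ?add0r; last first.
  by apply/matrixP => i j; rewrite !mxE /exp_poly expr0 -scalerAl mul1r derivZ derivC scaler0.
apply: eq_bigr => k _; apply/matrixP => i j.
by rewrite !mxE derivM derivC mulr0 addr0 deriv_exp_poly.
Qed.

Lemma mxeval0_exp p q (F : nat -> 'M[R]_(p, q)) N :
  mxeval 0 (\sum_(k < N.+1) exp_poly k *: mxC (F k)) = F 0%N.
Proof.
rewrite big_ord_recl raddfD raddf_sum /= big1 => [|k _]; apply/matrixP => i j.
  by rewrite !mxE /horner_eval /exp_poly /= !hornerE invr1 mul1r.
by rewrite !mxE /horner_eval /exp_poly /= !hornerE expr0n /= mulr0 mul0r.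
Qed.

End Antiderivative.

(** * A polynomial trajectory from the identity, and its observability *)

Section FlatTrajectory.
Variables (R : numFieldType) (n m : nat) (A : 'M[R]_n.+1) (B : 'M[R]_(n.+1, m)).
Variable L : 'I_n.+1 -> 'M[R]_(m, n.+1).
Hypothesis KL : \sum_(k < n.+1) A ^+ k *m B *m L k = 1%:M.

(* The controls are chosen so that the (n+1)-st Taylor coefficient vanishes,
   which makes the trajectory a polynomial. *)
Lemma poly_trajectory : exists (Z : 'M[{poly R}]_n.+1) (U : 'M[{poly R}]_(m, n.+1)),
  mxderiv Z = mxC A *m Z + mxC B *m U /\ mxeval 0 Z = 1%:M.
Proof.
(* With this choice the control terms in [F n.+1] sum to
   [- (\sum_k A^k B L_k) A^(n+1) = - A^(n+1)]. *)
pose V j := - (L (inord (n - j)) *m A ^+ n.+1).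
pose F := fix F k := if k is k'.+1 then A *m F k' + B *m V k' else 1%:M.
have FE k : F k = A ^+ k + \sum_(j < k) A ^+ (k - j.+1) *m B *m V j.
  elim: k => [|k IH]; first by rewrite big_ord0 addr0.
  rewrite /= IH big_ord_recr /= subnn expr0 mul1mx addrA; congr (_ + _).
  rewrite mulmxDr -[A *m _]/(A * A ^+ k) -exprS; congr (_ + _).
  rewrite mulmx_sumr; apply: eq_bigr => j _.
  by rewrite !mulmxA -[A *m _]/(A * _) -exprS -subSn.
have FN : F n.+1 = 0.
  rewrite FE (reindex_inj rev_ord_inj) /=.
  rewrite (eq_bigr (fun k : 'I_n.+1 => - (A ^+ k *m B *m L k *m A ^+ n.+1))).
    by rewrite sumrN -mulmx_suml KL mul1mx subrr.
  move=> k _; have kn : (k <= n)%N by rewrite -ltnS.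
  by rewrite /V mulmxN !subSS (subKn kn) inord_val mulmxA.
exists (\sum_(k < n.+1) exp_poly R k *: mxC (F k)).
exists (\sum_(k < n.+1) exp_poly R k *: mxC (V k)); split; last exact: mxeval0_exp.
rewrite mxderiv_exp // !mulmx_sumr -big_split; apply: eq_bigr => k _.
by rewrite /= map_mxD !map_mxM scalerDr -!scalemxAr.
Qed.

(* If [x adj(Z) B = 0] then the row vector [x Z^-1] solves the adjoint equation,
   and its successive derivatives are orthogonal to the columns of [A^k B]. *)
Lemma observable (Z : 'M[{poly R}]_n.+1) (U : 'M[{poly R}]_(m, n.+1)) (x : 'rV[R]_n.+1) :
  mxderiv Z = mxC A *m Z + mxC B *m U -> \det Z != 0 ->
  mxC x *m (\adj Z *m mxC B) = 0 -> x = 0.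
Proof.
move=> dZ d0 xN; set d := \det Z in d0.
have Zinj q (M N : 'M[{poly R}]_(q, n.+1)) : M *m Z = N *m Z -> M = N.
  move=> /(congr1 (mulmx^~ (\adj Z))); rewrite -!mulmxA mul_mx_adj -/d !mul_mx_scalar.
  move=> /matrixP h; apply/matrixP => i j; have := h i j; rewrite !mxE.
  exact: mulfI.
pose p := mxC x *m \adj Z.
have pB : p *m mxC B = 0 by rewrite -mulmxA.
have pZ : p *m Z = d *: mxC x by rewrite -mulmxA mul_adj_mx mul_mx_scalar.
(* Differentiating [p Z = d x] and using [p B = 0] gives [(p' + p A) Z = d' x]; this is the adjoint
   equation for [p / d] cleared of denominators. *)
have dp : d *: (mxderiv p + p *m mxC A) = d^`() *: p.
  apply: Zinj; rewrite -!scalemxAl mulmxDl.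
  have -> : mxderiv p *m Z + p *m mxC A *m Z = d^`() *: mxC x.
    have := mxderivM p Z; rewrite pZ dZ mulmxDr !mulmxA pB mul0mx addr0 => <-.
    by apply/matrixP => i j; rewrite !mxE derivM derivC mulr0 addr0.
  by rewrite pZ !scalerA mulrC.
have pk k : p *m mxC (A ^+ k *m B) = 0.
  elim: k => [|k IH]; first by rewrite expr0 mul1mx.
  have h : d *: (p *m mxC (A ^+ k.+1 *m B)) = 0.
    have -> : p *m mxC (A ^+ k.+1 *m B) = p *m mxC A *m mxC (A ^+ k *m B).
      by rewrite -mulmxA -map_mxM exprS mulmxA.
    have -> : d *: (p *m mxC A *m mxC (A ^+ k *m B)) =
       (d *: (mxderiv p + p *m mxC A)) *m mxC (A ^+ k *m B)
         - d *: mxderiv (p *m mxC (A ^+ k *m B)).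
      by rewrite mxderivMC -scalemxAl mulmxDl scalerDr addrC addKr.
    by rewrite dp -scalemxAl IH scaler0 map_mx0 scaler0 subr0.
  apply/matrixP => i j; move/matrixP/(_ i j): h; rewrite mxE [RHS]mxE => /eqP.
  by rewrite mulf_eq0 (negPf d0) /= => /eqP ->; rewrite mxE.
(* By [KL], [p] is the sum of the [p A^k B L_k]. *)
have p0 : p = 0.
  rewrite -[p]mulmx1 -(map_mx1 polyC) -KL raddf_sum mulmx_sumr big1 // => k _ /=.
  by rewrite map_mxM mulmxA pk mul0mx.
have /matrixP h : d *: mxC x = 0 by rewrite -pZ p0 mul0mx.
apply/matrixP => i j; have /eqP := h i j; rewrite 4!mxE mulf_eq0 (negPf d0) /=.
by rewrite polyC_eq0 => /eqP.
Qed.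

End FlatTrajectory.

(** * Gramian and steering *)

Section Steering.
Variable R : rcfType.

(** The [size p] equally spaced points of [[0, t[] are more than a nonzero [p] can have as roots. *)
Lemma poly_eq0_itv (p : {poly R}) t : 0 < t ->
  (forall s, 0 <= s <= t -> p.[s] = 0) -> p = 0.
Proof.
move=> t0 h; apply/eqP; apply: contraT => p0.
have sp : 0 < (size p)%:R :> R by rewrite ltr0n size_poly_gt0.
pose rs := [seq t * (i%:R / (size p)%:R) | i <- iota 0 (size p)].
have := @max_poly_roots _ p rs p0; rewrite size_map size_iota ltnn; apply.
  apply/allP => s /mapP[i]; rewrite mem_iota => /andP[_ ip] ->; apply/rootP/h.
  rewrite mulr_ge0 ?divr_ge0 ?(ltW t0) // ger_pMr // ler_pdivrMr // mul1r ler_nat.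
  exact: ltnW.
rewrite map_inj_uniq ?iota_uniq // => i j /(mulfI (lt0r_neq0 t0)).
by move/(mulIf (invr_neq0 (lt0r_neq0 sp)))/eqP; rewrite eqr_nat => /eqP.
Qed.

Section Gramian.
Variables (n m : nat) (N : 'M[{poly R}]_(n, m)).

(** The integral of [N N^T] from 0. Used with [N = \adj Z B] instead of [Z^-1 B], it stays
    polynomial. *)
Definition gramian : 'M[{poly R}]_n := map_mx (@polyint R) (N *m N^T).

Lemma mxderiv_gramian : mxderiv gramian = N *m N^T.
Proof. by apply/matrixP => i j; rewrite 2!mxE deriv_polyint. Qed.

Lemma gramian_tr : gramian^T = gramian.
Proof. by rewrite /gramian map_trmx trmx_mul trmxK. Qed.

Lemma mxeval0_gramian : mxeval 0 gramian = 0.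
Proof. by apply/matrixP => i j; rewrite 2!mxE /horner_eval horner_polyint0 mxE. Qed.

Let q (x : 'rV[R]_n) := mxform gramian (mxC x) (mxC x).

Lemma mxform_gramian (x : 'rV[R]_n) t : mxform (mxeval t gramian) x x = (q x).[t].
Proof.
rewrite /q /mxform -[RHS]/(horner_eval t _).
transitivity ((mxeval t (mxC x *m gramian *m (mxC x)^T)) 0 0); last by rewrite mxE.
by rewrite !map_mxM -map_trmx !mxevalC.
Qed.

Lemma deriv_mxform_gramian (x : 'rV[R]_n) : (q x)^`() = \sum_j ((mxC x *m N) 0 j) ^+ 2.
Proof.
transitivity ((mxderiv (mxC x *m gramian *m (mxC x)^T)) 0 0); first by rewrite [RHS]mxE.
rewrite map_trmx mxderivMC mxderivCM mxderiv_gramian -map_trmx mulmxA -mulmxA.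
rewrite -trmx_mul mxE; apply: eq_bigr => j _.
by rewrite [_^T _ _]mxE.
Qed.

(** The derivative of the form in time is a sum of squares. *)
Lemma gramian_mono (x : 'rV[R]_n) s t :
  s <= t -> mxform (mxeval s gramian) x x <= mxform (mxeval t gramian) x x.
Proof.
move=> st; rewrite !mxform_gramian.
apply: (@ler_hornerW _ s t); rewrite ?in_itv /= ?lexx ?st // => u _.
rewrite deriv_mxform_gramian horner_sum sumr_ge0 // => j _.
by rewrite horner_exp sqr_ge0.
Qed.

Lemma gramian_ge0 (x : 'rV[R]_n) t : 0 <= t -> 0 <= mxform (mxeval t gramian) x x.
Proof.
by move=> /(gramian_mono x); rewrite mxeval0_gramian /mxform mulmx0 mul0mx mxE.
Qed.

(** If the form at [x] vanishes at time [t], monotonicity makes it vanish on [[0, t]], hence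
    identically; its derivative [|x N|^2] is then 0, so [x N = 0]. *)
Lemma gramian_posdef t : 0 < t -> (forall x : 'rV[R]_n, mxC x *m N = 0 -> x = 0) ->
  posdef (mxeval t gramian).
Proof.
move=> t0 Ninj x x0; rewrite lt_neqAle gramian_ge0 ?ltW // andbT eq_sym.
apply: contra x0 => /eqP qt; apply/eqP/Ninj.
have q0 : q x = 0.
  apply: (poly_eq0_itv t0) => s /andP[s0 st]; apply: le_anti; rewrite -mxform_gramian.
  by rewrite gramian_ge0 // -qt gramian_mono.
have /polyP dq : (q x)^`() = 0 by rewrite q0 deriv0.
apply/rowP => j; rewrite [RHS]mxE; apply: (poly_eq0_itv ltr01) => s _; apply/eqP.
have : \sum_j ((mxC x *m N) 0 j).[s] ^+ 2 == 0.
  have := deriv_mxform_gramian x; rewrite q0 deriv0 => /(congr1 (horner_eval s)).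
  rewrite /horner_eval horner0 horner_sum => /esym/eqP.
  by under eq_bigr do rewrite horner_exp.
rewrite psumr_eq0 => [/allP /(_ j (mem_index_enum _))|k _]; last exact: sqr_ge0.
by rewrite /= sqrf_eq0.
Qed.

(* [0 <= W <= WT] is all that is needed to keep the interpolation invertible. *)
Lemma interpolation_unit (W WT S : 'M[R]_n) :
  W^T = W -> WT^T = WT -> posdef WT -> posdef S ->
  (forall x, 0 <= mxform W x x <= mxform WT x x) ->
  1%:M + W *m (S - invmx WT) \in unitmx.
Proof.
move=> sW sWT pWT pS hW; rewrite -unitmx_tr; apply: unitmx_ker0 => v.
have uWT := posdef_unit pWT.
rewrite linearD /= trmx1 trmx_mul sW linearB /= trmx_inv sWT mulmxDr mulmx1 mulmxA.
(* A kernel vector of the transpose satisfies [v = - y W = - z WT]. *)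
set y := v *m _ => hv; pose z := - (v *m invmx WT).
have vz : v = - (z *m WT) by rewrite mulNmx opprK mulmxKV.
have zy : z *m WT = y *m W.
  by apply/eqP; rewrite -subr_eq0 -oppr_eq0 opprB addrC -vz hv.
apply/eqP; apply: contraT => v0; have := posdef_tr pS v0; rewrite ltNge => /negP[].
have -> : S^T = (S^T - invmx WT) + invmx WT by rewrite subrK.
(* The form of [S^T] at [v] equals [WT(z, z) - W(y, y)], to be shown nonpositive. *)
rewrite mxformD.
have -> : mxform (S^T - invmx WT) v v = - mxform W y y.
  by rewrite /mxform -/y vz zy linearN /= mulmxN mxE trmx_mul sW mulmxA.
have -> : mxform (invmx WT) v v = mxform WT z z.
  rewrite /mxform -[v *m invmx WT]opprK -/z {1}vz [(- _)^T]linearN /= mulmxN mulNmx opprK.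
  by rewrite trmx_mul sWT mulmxA.
have zz : mxform WT z z = mxform W z y.
  by rewrite /mxform -mulmxA -{1}sWT -trmx_mul zy trmx_mul sW mulmxA.
have zy' : mxform W y z = mxform W z y by rewrite -mxform_tr sW.
(* From [W(z - y, z - y) >= 0] and [W(z, z) <= WT(z, z) = W(z, y)] follows [WT(z, z) <= W(y, y)]. *)
clearbody z y; have := hW z; have /andP[+ _] := hW (z - y).
rewrite mxformDl !mxformDr !mxformNl !mxformNr zy'.
by move=> h1 /andP[_ h2]; lra.
Qed.

End Gramian.

(** [G] and [T] are chosen before [S], since the semigroup argument needs a single [G]. *)
Lemma poly_steering n m (A : 'M[R]_n.+1) (B : 'M[R]_(n.+1, m)) (L : 'I_n.+1 -> 'M[R]_(m, n.+1)) :
  \sum_(k < n.+1) A ^+ k *m B *m L k = 1%:M ->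
  exists G T, [/\ 0 < \det G, 0 < T & forall S, posdef S ->
    exists (P : 'M[{poly R}]_n.+1) (V : 'M[{poly R}]_(m, n.+1)),
      [/\ mxderiv P = mxC A *m P + mxC B *m V, mxeval 0 P = 1%:M, mxeval T P = G *m S &
          forall t, 0 <= t <= T -> mxeval t P \in unitmx]].
Proof.
move=> KL; have [Z [U [dZ Z0]]] := poly_trajectory KL.
have detE (t : R) : (\det Z).[t] = \det (mxeval t Z) by rewrite det_map_mx.
(* Near 0, [\det Z] stays within 1 of its value 1, hence positive; halving [r] gives a closed
   interval. *)
have [r r0 hr] := @poly_cont R 0 (\det Z) 1 ltr01.
pose T := r / 2; have T0 : 0 < T by rewrite divr_gt0.
have dZpos (t : R) : 0 <= t <= T -> 0 < \det (mxeval t Z).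
  move=> /andP[t0 tT]; have := hr t; rewrite !detE Z0 det1 subr0 ger0_norm //.
  have tr : t < r by rewrite (le_lt_trans tT) // /T; lra.
  by move=> /(_ tr); rewrite ltr_distl subrr => /andP[].
pose N := \adj Z *m mxC B; pose W := gramian N; pose WT := mxeval T W.
have d0 : \det Z != 0.
  apply: contraTneq (dZpos 0 _) => [d0|]; last by rewrite lexx ltW.
  by rewrite -detE d0 horner0 ltxx.
have pWT : posdef WT.
  by apply: gramian_posdef => // x; exact: observable KL Z U x dZ d0.
have uWT := posdef_unit pWT.
exists (mxeval T Z *m WT), T; split => //.
  rewrite det_mulmx; apply: mulr_gt0; last exact: posdef_det_gt0.
  by apply: dZpos; rewrite lexx ltW.
move=> S pS; pose C := S - invmx WT; pose Y := 1%:M + W *m mxC C.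
(* [Z Y' = Z \adj Z B N^T C = \det Z B N^T C], so this term too has the form [B] times a control. *)
exists (Z *m Y), (U *m Y + \det Z *: (N^T *m mxC C)); split.
- rewrite mxderivM dZ [mxderiv Y]raddfD /= mxderivMC mxderiv_gramian.
  rewrite -(map_mx1 polyC) mxderivC add0r mulmxDl [mxC B *m (_ + _)]mulmxDr.
  rewrite !mulmxA -addrA; congr (_ + (_ + _)).
  by rewrite mul_mx_adj mul_scalar_mx -!scalemxAl -scalemxAr mulmxA.
- by rewrite map_mxM Z0 mul1mx map_mxD map_mx1 map_mxM mxeval0_gramian mul0mx addr0.
- rewrite map_mxM map_mxD map_mx1 map_mxM mxevalC -/WT -mulmxA; congr (_ *m _).
  by rewrite /C mulmxBr mulmxV // addrC subrK.
move=> t t0T; have /andP[t0 tT] := t0T.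
rewrite map_mxM unitmx_mul unitmxE unitfE gt_eqF ?dZpos //=.
rewrite map_mxD map_mx1 map_mxM mxevalC; apply: interpolation_unit => //.
- by rewrite map_trmx gramian_tr.
- by rewrite map_trmx gramian_tr.
- by move=> x; rewrite gramian_ge0 //= gramian_mono.
Qed.

End Steering.

(** * Reachability *)

Lemma is_derive_mx (R : realType) p q (F : R -> 'M[R]_(p, q)) (s : R) (dF : 'M[R]_(p, q)) :
  (forall i j, is_derive s 1 (fun u => F u i j) (dF i j)) -> is_derive s 1 F dF.
Proof.
move=> h; have dF' : derivable F s 1 by apply/derivable_mxP => i j; have [] := h i j.
apply: DeriveDef => //; rewrite derive_mx //.
by apply/matrixP => i j; rewrite mxE; have [] := h i j.
Qed.

(** A stronger substitute for absolute continuity, preserved by gluing and by right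
    multiplication. *)
Definition mxlipschitz (R : realType) p q (a b : R) (F : R -> 'M[R]_(p, q)) : Prop :=
  exists M, 0 <= M /\ forall i j x y, a <= x <= b -> a <= y <= b ->
    `|F x i j - F y i j| <= M * `|x - y|.

Lemma mxlipschitz_abs_continuous (R : realType) p q (a b : R) (F : R -> 'M[R]_(p, q)) :
  mxlipschitz a b F -> abs_continuous_on a b F.
Proof.
move=> [M [M0 hM]] eps eps0; have M1 : 0 < M + 1 by rewrite ltr_wpDl.
(* [M + 1] because [M] may be 0. *)
exists (eps / (M + 1)) => [|N u v huv _]; first by rewrite divr_gt0.
rewrite ltr_pdivlMr // mulrC mulr_sumr; apply: le_lt_trans; apply: ler_sum => i _.
have [au [uv vb]] := huv i; have uv0 : 0 <= v i - u i by rewrite subr_ge0.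
rewrite [leLHS]/Num.Def.normr /= mx_normrE; apply: bigmax_le => [|[k l] _ /=].
  by rewrite mulr_ge0 // ltW.
rewrite !mxE; apply: le_trans (hM _ _ _ _ _ _) _; rewrite ?au ?vb ?(le_trans au) ?(le_trans uv) //.
by rewrite ger0_norm // ler_wpM2r // lerDl.
Qed.

Definition bounded_measurable (R : realType) (f : R -> R) : Prop :=
  measurable_fun setT f /\ exists M, forall x, `|f x| <= M.

(* Reachability by controls and trajectories regular enough to be glued. *)
Definition steers (R : realType) n m (A : 'M[R]_n) (B : 'M[R]_(n, m)) (X : 'M[R]_n) : Prop :=
  exists (t : R) (K : R -> 'M[R]_(m, n)) (Phi : R -> 'M[R]_n) (E : seq R), 0 < t /\
  [/\ forall i j, bounded_measurable (fun s => K s i j),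
      mxlipschitz 0 t Phi,
      forall s : R, 0 < s < t -> s \notin E -> forall i j,
        is_derive s 1 (fun u => Phi u i j) (((A + B *m K s) *m Phi s) i j),
      Phi 0 = 1%:M & Phi t = X].

(** Bounded measurable controls are integrable on [[0, t]], Lipschitz trajectories are absolutely
    continuous, and the finite set [E] is null. *)
Lemma steers_controllable (R : realType) n m (A : 'M[R]_n) (B : 'M[R]_(n, m)) :
  (forall X, GLplus X -> steers A B X) -> bilinear_controllable A B.
Proof.
move=> h X /h [t [K [Phi [E [t0 [bK lPhi dPhi Phi0 Phit]]]]]]; exists t; split => //.
exists K => [i j|].
  have [mK [M hM]] := bK i j.
  apply: (@measurable_bounded_integrable _ _ _ lebesgue_measure (fun s => K s i j)) => //.
  - by rewrite /= lebesgue_measure_itv /= lte_fin t0 -EFinB ltry.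
  - exact: measurable_funTS.
  - by exists M; split => [|x Mx s _]; [exact: num_real|exact: le_trans (hM s) (ltW Mx)].
exists Phi => //; split => //; first exact: mxlipschitz_abs_continuous.
have : lebesgue_measure [set` E] = 0%E :> \bar R.
  exact/countable_lebesgue_measure0/finite_set_countable/finite_seq.
move=> E0; exists [set` E]; split => //.
  exact/countable_measurable/finite_set_countable/finite_seq.
move=> s /= /not_implyP[]; rewrite in_itv /= => s0t ns; apply: contrapT => sE; apply: ns.
by apply: is_derive_mx; apply: dPhi => //; apply/negP.
Qed.

(** Continuity on a compact interval gives measurability of the restriction and, by the extreme
    value theorem, a bound. *)
Lemma bounded_measurable_patch (R : realType) (t : R) (f : R -> R) :
  0 < t -> {in `[0, t]%R, continuous f} ->
  bounded_measurable (fun s => if 0 <= s <= t then f s else 0).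
Proof.
move=> t0 cf; have cf' : {within `[0, t], continuous f}.
  by apply: continuous_in_subspaceT => s; rewrite inE /=; exact: cf.
have -> : (fun s => if 0 <= s <= t then f s else 0) = f \_ `[0, t].
  by apply/funext => s; rewrite patchE mem_setE in_itv.
split.
  apply/(measurable_restrictT f (measurable_itv _)).
  exact: subspace_continuous_measurable_fun.
have [c _ hc] : exists2 c, c \in `[0, t]%R & forall s, s \in `[0, t]%R -> `|f s| <= `|f c|.
  apply: (@EVT_max _ (fun s => `|f s|)); first exact: ltW.
  move=> s; apply: continuous_comp; first exact: cf'.
  exact: norm_continuous.
exists `|f c| => s; rewrite patchE mem_setE; case: ifP => [/hc//|_].
by rewrite normr0.
Qed.

Lemma poly_steers (R : realType) n m (A : 'M[R]_n) (B : 'M[R]_(n, m))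
    (P : 'M[{poly R}]_n) (V : 'M[{poly R}]_(m, n)) T : 0 < T ->
  mxderiv P = mxC A *m P + mxC B *m V -> mxeval 0 P = 1%:M ->
  (forall t, 0 <= t <= T -> mxeval t P \in unitmx) -> steers A B (mxeval T P).
Proof.
move=> T0 dP P0 uP.
(* The feedback [V P^-1], cut off outside [[0, T]], where [P] may be singular. *)
pose K s : 'M[R]_(m, n) := if 0 <= s <= T then mxeval s V *m invmx (mxeval s P) else 0.
exists T, K, (fun s => mxeval s P), [::]; split => //; split => //.
- move=> i j.
  (* By the adjugate formula the entries of [V P^-1] are rational with denominator [\det P], nonzero
     on [[0, T]]. *)
  pose f s := (\det P).[s]^-1 * ((V *m \adj P) i j).[s].
  have -> : (fun s => K s i j) = (fun s => if 0 <= s <= T then f s else 0).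
    apply/funext => s; rewrite /K; case: ifP => [sT|_]; last by rewrite mxE.
    rewrite /invmx uP // /f -scalemxAr mxE; congr (_^-1 * _).
      by rewrite det_map_mx.
    by rewrite -map_mx_adj -map_mxM mxE.
  apply: bounded_measurable_patch => // s; rewrite in_itv /= => sT.
  apply: cvgM; last exact: continuous_horner.
  apply: cvgV; last exact: continuous_horner.
  by have := uP _ sT; rewrite unitmxE det_map_mx unitfE.
- pose k i j := sval (poly_lipshitz (P i j) 0 T).
  have k0 i j : 0 <= k i j.
    by rewrite /k; case: poly_lipshitz => /= c c1 _; rewrite (le_trans _ c1).
  have kP i j x y : x \in `[0, T]%R -> y \in `[0, T]%R ->
      `|(P i j).[y] - (P i j).[x]| <= k i j * `|y - x|.
    by rewrite /k; case: poly_lipshitz => /= c _; exact.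
  exists (\sum_i \sum_j k i j); split; first by do 2!(apply: sumr_ge0 => ? _).
  move=> i j x y hx hy; rewrite !mxE; apply: le_trans (kP i j y x _ _) _.
  - by rewrite in_itv.
  - by rewrite in_itv.
  apply: ler_wpM2r => //; rewrite (bigD1 i) //= (bigD1 j) //= -addrA lerDl.
  by rewrite addr_ge0 ?sumr_ge0 // => ? _; rewrite sumr_ge0.
- move=> s /andP[s0 sT] _ i j; have sT' : 0 <= s <= T by rewrite !ltW.
  have -> : (A + B *m K s) *m mxeval s P = mxeval s (mxderiv P).
    by rewrite dP map_mxD !map_mxM !mxevalC /K sT' mulmxDl -!mulmxA mulVmx ?uP // mulmx1.
  rewrite !mxE; have -> : (fun u => mxeval u P i j) = horner (P i j).
    by apply/funext => u; rewrite mxE.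
  exact: is_derive_poly.
Qed.

Lemma mxlipschitz_glue (R : realType) p q (t1 t2 : R) (F G : R -> 'M[R]_(p, q)) :
  0 < t1 -> mxlipschitz 0 t1 F -> mxlipschitz 0 t2 G -> F t1 = G 0 ->
  mxlipschitz 0 (t1 + t2) (fun s => if s <= t1 then F s else G (s - t1)).
Proof.
move=> t1_gt0 [M [M0 hM]] [N [N0 hN]] FG; exists (M + N); split; first exact: addr_ge0.
move=> i j; suff h x y : 0 <= x -> x <= y -> y <= t1 + t2 ->
    `|(if x <= t1 then F x else G (x - t1)) i j -
      (if y <= t1 then F y else G (y - t1)) i j| <= (M + N) * (y - x).
  move=> x y /andP[x0 xt] /andP[y0 yt]; have [xy|yx] := leP x y.
    by rewrite (distrC x) (ger0_norm (_ : 0 <= y - x)) ?subr_ge0 //; exact: h.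
  rewrite distrC (gtr0_norm (_ : 0 < x - y)) ?subr_gt0 //.
  by apply: h => //; exact: ltW.
move=> x0 xy yt; rewrite mulrDl.
have My : 0 <= M * (y - x) by rewrite mulr_ge0 ?subr_ge0.
have Ny : 0 <= N * (y - x) by rewrite mulr_ge0 ?subr_ge0.
case: (leP y t1) => [yt1|yt1].
  rewrite (le_trans xy yt1) ler_wpDr //.
  have := hM i j x y; rewrite distrC (ler0_norm (_ : x - y <= 0)) ?subr_le0 // opprB distrC.
  by apply; rewrite ?x0 ?yt1 ?(le_trans xy) ?(le_trans x0).
case: (leP x t1) => [xt1|xt1].
  (* The points straddle [t1]: the difference is split at the common value [F t1 = G 0]. *)
  rewrite -(subrKA (F t1 i j)) (le_trans (ler_normD _ _)) // lerD //.
    apply: le_trans (hM i j x t1 _ _) _; rewrite ?x0 ?xt1 ?lexx ?(ltW t1_gt0) //.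
    by rewrite ler_wpM2l // distrC ger0_norm ?subr_ge0 // lerD2r ltW.
  rewrite FG; apply: le_trans (hN i j 0 (y - t1) _ _) _; first by lra.
    by apply/andP; lra.
  by rewrite ler_wpM2l // sub0r normrN ger0_norm; lra.
apply: le_trans (hN i j (x - t1) (y - t1) _ _) _; try by apply/andP; lra.
rewrite ler_wpDl // ler_wpM2l // opprB addrA subrK distrC ger0_norm ?subr_ge0 //.
Qed.



Lemma mxlipschitzMr (R : realType) p q r (a b : R) (F : R -> 'M[R]_(p, q)) (C : 'M[R]_(q, r)) :
  mxlipschitz a b F -> mxlipschitz a b (fun s => F s *m C).
Proof.
move=> [M [M0 hM]]; exists (M * \sum_k \sum_j `|C k j|); split.
  by rewrite mulr_ge0 //; do 2!(apply: sumr_ge0 => ? _).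
move=> i j x y hx hy; rewrite !mxE -sumrB (le_trans (ler_norm_sum _ _ _)) //.
rewrite mulrAC mulr_sumr; apply: ler_sum => k _; rewrite -mulrBl normrM.
apply: ler_pM => //; first exact: hM.
by rewrite (bigD1 j) //= lerDl sumr_ge0.
Qed.

Lemma bounded_measurable_glue (R : realType) (t : R) (f g : R -> R) :
  bounded_measurable f -> bounded_measurable g ->
  bounded_measurable (fun s => if s <= t then f s else g (s - t)).
Proof.
move=> [mf [M hM]] [mg [N hN]]; split.
  apply: measurable_fun_ifT => //; first exact: measurable_fun_ler.
  by apply: (measurableT_comp mg); exact: measurable_funB.
exists (`|M| + `|N|) => x; case: ifP => _.
  by rewrite (le_trans (hM x)) // (le_trans (ler_norm M)) // lerDl.
by rewrite (le_trans (hN _)) // (le_trans (ler_norm N)) // lerDr.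
Qed.

Lemma is_derive_shift_mulmx (R : realType) p q r (F : R -> 'M[R]_(p, q)) (C : 'M[R]_(q, r))
    (dF : 'M[R]_(p, q)) (s t : R) :
  (forall i j, is_derive (s - t) 1 (fun u => F u i j) (dF i j)) ->
  forall i j, is_derive s 1 (fun u => (F (u - t) *m C) i j) ((dF *m C) i j).
Proof.
move=> dFst i j.
have -> : (fun u => (F (u - t) *m C) i j) =
    \sum_k (C k j \*: ((fun u => F u i k) \o shift (- t))).
  apply/funext => u; rewrite fct_sumE mxE; apply: eq_bigr => k _.
  by rewrite mulrC.
rewrite mxE (eq_bigr (fun k => C k j *: (dF i k * 1))) => [|k _]; last first.
  by rewrite mulr1 mulrC.
apply: is_derive_sum => k; apply: is_deriveZ; apply: is_derive1_comp.
exact: is_derive_shift.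
Qed.

(** The equation is invariant under right multiplication of [Phi] by a constant: after [K1] has
    reached [X1], the shifted [K2] moves the state along [F2 X1]. *)
Lemma steersM (R : realType) n m (A : 'M[R]_n) (B : 'M[R]_(n, m)) (X2 X1 : 'M[R]_n) :
  steers A B X2 -> steers A B X1 -> steers A B (X2 *m X1).
Proof.
move=> [t2 [K2 [F2 [E2 [t2_gt0 [bK2 lF2 dF2 F20 F2t]]]]]].
move=> [t1 [K1 [F1 [E1 [t1_gt0 [bK1 lF1 dF1 F10 F1t]]]]]].
exists (t1 + t2), (fun s => if s <= t1 then K1 s else K2 (s - t1)).
exists (fun s => if s <= t1 then F1 s else F2 (s - t1) *m X1).
(* The junction time joins the exceptional set, since the two one-sided derivatives may differ
   there. *)
exists (t1 :: E1 ++ [seq e + t1 | e <- E2]); split; first exact: addr_gt0.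
split.
- move=> i j; have := bounded_measurable_glue t1 (bK1 i j) (bK2 i j).
  by congr bounded_measurable; apply/funext => s; case: ifP.
- apply: (mxlipschitz_glue (G := fun s => F2 s *m X1)) => //; last by rewrite F20 mul1mx.
  exact: mxlipschitzMr.
- move=> s /andP[s0 st]; rewrite inE mem_cat !negb_or => /and3P[sn1 sE1 sE2] i j.
  have [st1|t1s] := leP s t1.
    have {}st1 : s < t1 by rewrite lt_neqAle sn1.
    apply: near_eq_is_derive (dF1 s _ sE1 i j); last by rewrite s0.
    by near=> u; rewrite ifT // ltW //; near: u; exact: lt_nbhsl.
  apply: near_eq_is_derive.
    by near=> u; rewrite ifF; [|apply/negbTE; rewrite -ltNge; near: u; exact: lt_nbhsr].
  rewrite mulmxA; apply: is_derive_shift_mulmx; apply: dF2.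
    by apply/andP; lra.
  by apply: contra sE2 => h; apply/mapP; exists (s - t1); rewrite ?subrK.
- by rewrite ltW.
- by rewrite gerDl leNgt t2_gt0 /= addrC addKr F2t.
Unshelve. all: by end_near. Qed.

(** Full row rank gives a right inverse, which is cut into blocks [L k] matching the [A^k B]. *)
Lemma kalman_right_inverse (R : realType) n m (A : 'M[R]_n) (B : 'M[R]_(n, m)) :
  kalman_rank_condition A B ->
  exists L : 'I_n -> 'M[R]_(m, n), \sum_(k < n) A ^+ k *m B *m L k = 1%:M.
Proof.
move=> rk; have /row_freeP[L hL] : row_free (kalman_mx A B) by rewrite /row_free rk.
exists (fun k => submxcol L k).
by rewrite -mul_mxrow_mxcol submxcolK.
Qed.

Theorem theorem1 (R : realType) (n m : nat) (hn : (1 <= n)%N) (hm : (1 <= m)%N)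
    (A : 'M[R]_n) (B : 'M[R]_(n, m)) (hB : \rank B = m)
    (hAB : kalman_rank_condition A B) :
  bilinear_controllable A B.
Proof.
case: n hn A B hB hAB => // n _ A B _ /kalman_right_inverse[L KL].
have [G [T [G0 T0 hG]]] := poly_steering KL.
apply: steers_controllable; apply: (semigroup_GLplus (@steersM _ _ _ A B) G0).
move=> S /hG [P [V [dP P0 <- uP]]]; exact: poly_steers dP P0 uP.
Qed.
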